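(* Let $\epsilon=\pm1$, $0<q\in\mathbb{Q}$, $\gamma\in\mathbb{N}$, $\delta\in\mathbb{N}\cup\{0\}$ and $N\in\mathbb{N}$. Then the power series $$\phi_{\gamma,\delta}^{\epsilon,q}(x)=\sum_{n=0}^{\infty}\epsilon^n\,\frac{((\gamma n+\delta)!)^{\gamma n+\delta}}{q+((\gamma n+\delta)!)^{N(\gamma n+\delta)}}\,\frac{x^{\gamma n+\delta}}{(\gamma n+\delta)!}$$ converges for all $x\in\mathbb{R}$, and converges for all $x\in\mathbb{Q}_p$ for every prime $p$.
   Context: $\mathbb{N}$ denotes the positive integers. $\mathbb{Q}_p$ is the field of $p$-adic numbers; convergence in $\mathbb{R}$ is with respect to the usual absolute value and in $\mathbb{Q}_p$ with respect to the $p$-adic absolute value. The coefficients are rational numbers, regarded as elements of $\mathbb{R}$ or of $\mathbb{Q}_p$. *)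

(* Defs.v *)
From HB Require Import structures.
From mathcomp Require Import all_boot all_order all_algebra.
From mathcomp Require Import generic_quotient ring_quotient.
From mathcomp Require Import all_classical all_reals all_analysis.
From mathcomp Require Import ring lra zify.

Set Implicit Arguments.
Unset Strict Implicit.
Unset Printing Implicit Defensive.

Import Order.TTheory GRing.Theory Num.Theory.
Import numFieldNormedType.Exports.

Local Open Scope classical_set_scope.
Local Open Scope ring_scope.
Local Open Scope quotient_scope.

Definition padic_val (p : nat) (x : rat) : int :=
  (logn p `|numq x|%N)%:Z - (logn p `|denq x|%N)%:Z.

(* When p is not prime, logn p is constantly 0, and this is the trivial
   absolute value; thus none of the constructions below assumes p prime. *)
Definition padic_abs (p : nat) (x : rat) : rat :=
  if x == 0 then 0 else p%:R ^ (- padic_val p x).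

Section PadicAbs.
Variable p : nat.
Implicit Types (x y z : rat) (a b : int).

Local Notation pabs := (padic_abs p).

Lemma padic_val_frac a b : a != 0 -> b != 0 ->
  padic_val p (a%:~R / b%:~R) = (logn p `|a|%N)%:Z - (logn p `|b|%N)%:Z.
Proof.
move=> a0 b0; set x : rat := _ / _.
have x0 : x != 0 by rewrite mulf_neq0 ?invr_eq0 ?intr_eq0.
have e : numq x * b = a * denq x.
  apply/eqP; rewrite -(eqr_int rat) !rmorphM /=; apply/eqP.
  have /eqP := divq_num_den x; rewrite {2}/x.
  by rewrite eqr_div ?intr_eq0 ?denq_neq0 // => /eqP ->.
have := congr1 (fun z : int => logn p `|z|%N) e.
rewrite !abszM !lognM ?absz_gt0 ?numq_eq0 ?denq_neq0 // /padic_val.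
move=> {}e; lia.
Qed.

Lemma padic_abs_nonprime x : x != 0 -> ~~ prime p -> pabs x = 1.
Proof.
move=> x0 /negbTE np; rewrite /padic_abs (negbTE x0) /padic_val.
have l0 n : logn p n = 0%N by rewrite lognE np.
by rewrite !l0 subrr oppr0 expr0z.
Qed.

Lemma padic_abs0 : pabs 0 = 0.
Proof. by rewrite /padic_abs eqxx. Qed.

Lemma padic_abs_gt0 x : x != 0 -> 0 < pabs x.
Proof.
move=> x0; have [pp|np] := boolP (prime p); last by rewrite padic_abs_nonprime.
by rewrite /padic_abs (negbTE x0) exprz_gt0 // ltr0n prime_gt0.
Qed.

Lemma padic_abs_ge0 x : 0 <= pabs x.
Proof.
by have [->|/padic_abs_gt0/ltW//] := eqVneq x 0; rewrite padic_abs0.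
Qed.

Lemma padic_abs_eq0 x : (pabs x == 0) = (x == 0).
Proof.
have [->|x0] := eqVneq x 0; first by rewrite padic_abs0 eqxx.
by rewrite gt_eqF // padic_abs_gt0.
Qed.

Lemma padic_abs1 : pabs 1 = 1.
Proof.
by rewrite /padic_abs oner_eq0 /padic_val (numq_int 1) (denq_int 1) logn1.
Qed.

Lemma padic_absN x : pabs (- x) = pabs x.
Proof. by rewrite /padic_abs oppr_eq0 /padic_val numqN denqN abszN. Qed.

Lemma padic_absB x y : pabs (x - y) = pabs (y - x).
Proof. by rewrite -padic_absN opprB. Qed.

Lemma padic_absM x y : pabs (x * y) = pabs x * pabs y.
Proof.
have [->|x0] := eqVneq x 0; first by rewrite mul0r padic_abs0 mul0r.
have [->|y0] := eqVneq y 0; first by rewrite mulr0 padic_abs0 mulr0.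
have [pp|np] := boolP (prime p); last first.
  by rewrite !padic_abs_nonprime ?mulf_neq0 ?mulr1.
rewrite /padic_abs mulf_eq0 (negbTE x0) (negbTE y0) /=.
rewrite -expfzDr ?pnatr_eq0 -?lt0n ?prime_gt0 //; congr (_ ^ _).
have {1}-> : x * y =
    (numq x * numq y)%:~R / (denq x * denq y)%:~R.
  rewrite -[x in LHS]divq_num_den -[y in LHS]divq_num_den !rmorphM /=.
  by rewrite mulrACA invfM.
rewrite padic_val_frac ?mulf_neq0 ?numq_eq0 ?denq_neq0 //.
rewrite !abszM !lognM ?absz_gt0 ?numq_eq0 ?denq_neq0 // /padic_val; lia.
Qed.

Lemma padic_absV x : pabs (x^-1)%R = (pabs x)^-1.
Proof.
have [->|x0] := eqVneq x 0; first by rewrite !(invr0, padic_abs0).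
apply: (mulIf (x := pabs x)); first by rewrite padic_abs_eq0.
by rewrite -padic_absM !mulVf ?padic_abs1 ?padic_abs_eq0.
Qed.

Lemma padic_absD_max x y : pabs (x + y) <= Num.max (pabs x) (pabs y).
Proof.
have [->|x0] := eqVneq x 0; first by rewrite add0r le_max lexx orbT.
have [->|y0] := eqVneq y 0; first by rewrite addr0 le_max lexx.
have [->|xy0] := eqVneq (x + y) 0.
  by rewrite padic_abs0 le_max padic_abs_ge0.
have [pp|np] := boolP (prime p); last first.
  by rewrite !padic_abs_nonprime // le_max lexx.
set a := numq x * denq y; set b := numq y * denq x; set c := denq x * denq y.
have c0 : c != 0 by rewrite mulf_neq0 ?denq_neq0.
have cr0 : c%:~R != 0 :> rat by rewrite intr_eq0.
have [dx0 dy0] : (denq x)%:~R != 0 :> rat /\ (denq y)%:~R != 0 :> rat.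
  by rewrite !intr_eq0 !denq_neq0.
have ex : x = a%:~R / c%:~R.
  rewrite -[LHS]divq_num_den /a /c !rmorphM /=; field.
  by rewrite dx0 dy0.
have ey : y = b%:~R / c%:~R.
  rewrite -[LHS]divq_num_den /b /c !rmorphM /=; field.
  by rewrite dx0 dy0.
have exy : x + y = (a + b)%:~R / c%:~R by rewrite {1}ex {1}ey -mulrDl rmorphD.
have a0 : a != 0 by rewrite mulf_neq0 ?numq_eq0 ?denq_neq0.
have b0 : b != 0 by rewrite mulf_neq0 ?numq_eq0 ?denq_neq0.
have ab0 : a + b != 0.
  by apply: contraNneq xy0 => e; rewrite exy e mul0r.
have vx := padic_val_frac a0 c0; have vy := padic_val_frac b0 c0.
have vxy := padic_val_frac ab0 c0; rewrite -ex in vx; rewrite -ey in vy.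
rewrite -exy in vxy.
rewrite /padic_abs (negbTE x0) (negbTE y0) (negbTE xy0) le_max vx vy vxy.
have p1 : 1 < p%:R :> rat by rewrite ltr1n prime_gt1.
rewrite !ler_eXz2l //.
suff : ((logn p `|a| <= logn p `|(a + b)%R|) || (logn p `|b| <= logn p `|(a + b)%R|))%N.
  by lia.
have h k : (k <= logn p `|a|)%N -> (k <= logn p `|b|)%N ->
    (k <= logn p `|(a + b)%R|)%N.
  move=> ka kb; rewrite -pfactor_dvdn ?absz_gt0 //.
  have : ((p ^ k)%:Z %| a + b)%Z.
    by apply: rpredD; rewrite dvdzE /= pfactor_dvdn ?absz_gt0.
  by rewrite dvdzE.
case/orP: (leq_total (logn p `|a|) (logn p `|b|)) => ab.
  by rewrite h.
by apply/orP; right; rewrite h.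
Qed.

Lemma padic_absD x y : pabs (x + y) <= pabs x + pabs y.
Proof.
apply: le_trans (padic_absD_max x y) _.
by rewrite ge_max lerDl lerDr !padic_abs_ge0.
Qed.

Lemma padic_absD_eq x y : pabs y < pabs x -> pabs (x + y) = pabs x.
Proof.
move=> xy; apply/eqP; rewrite eq_le; apply/andP; split.
  by apply: le_trans (padic_absD_max x y) _; rewrite ge_max lexx ltW.
have := padic_absD_max (x + y) (- y); rewrite addrK padic_absN le_max.
by rewrite (leNgt (pabs x) (pabs y)) xy orbF.
Qed.

End PadicAbs.

Definition padic_cauchy (p : nat) : {pred nat -> rat} :=
  [pred u : nat -> rat | `[< forall e : rat, 0 < e -> exists M : nat,
     forall m n, (M <= m)%N -> (M <= n)%N -> padic_abs p (u m - u n) < e >]].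

Section CauchyRing.
Variable p : nat.
Local Notation pabs := (padic_abs p).
Implicit Types u v : nat -> rat.

Lemma padic_cauchyP u : reflect
  (forall e : rat, 0 < e -> exists M : nat,
     forall m n, (M <= m)%N -> (M <= n)%N -> pabs (u m - u n) < e)
  (u \in padic_cauchy p).
Proof. exact: asboolP. Qed.

Lemma padic_cauchy_bounded u : u \in padic_cauchy p ->
  exists2 B, 0 < B & exists M : nat, forall n, (M <= n)%N -> pabs (u n) < B.
Proof.
move=> /padic_cauchyP /(_ 1 ltr01) [M h]; exists (1 + pabs (u M)).
  by rewrite ltr_pwDl // padic_abs_ge0.
exists M => n Mn; rewrite -[u n](subrK (u M)).
by apply: le_lt_trans (padic_absD _ _ _) _; rewrite ltrD2r h.
Qed.

Lemma padic_cauchy_subring : subring_closed (padic_cauchy p).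
Proof.
split=> [|u v /padic_cauchyP hu /padic_cauchyP hv|u v uC vC].
- by apply/padic_cauchyP => e e0; exists 0%N => m n _ _; rewrite subrr padic_abs0.
- apply/padic_cauchyP => e e0; have e2 : 0 < e / 2 by rewrite divr_gt0.
  have [M hM] := hu _ e2; have [M' hM'] := hv _ e2.
  exists (maxn M M') => m n; rewrite !geq_max => /andP[m1 m2] /andP[n1 n2].
  have -> : (u - v) m - (u - v) n = (u m - u n) + (v n - v m).
    by rewrite -[LHS]/(u m - v m - (u n - v n)); ring.
  by apply: le_lt_trans (padic_absD _ _ _) _; rewrite [e]splitr ltrD ?hM ?hM'.
- have [B B0 [M1 hB]] := padic_cauchy_bounded uC.
  have [C C0 [M2 hC]] := padic_cauchy_bounded vC.
  apply/padic_cauchyP => e e0.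
  have eB : 0 < e / 2 / B by rewrite !divr_gt0.
  have eC : 0 < e / 2 / C by rewrite !divr_gt0.
  have [M3 h3] := padic_cauchyP _ uC _ eC; have [M4 h4] := padic_cauchyP _ vC _ eB.
  exists (maxn (maxn M1 M2) (maxn M3 M4)) => m n; rewrite !geq_max.
  move=> /andP[/andP[m1 m2] /andP[m3 m4]] /andP[/andP[n1 n2] /andP[n3 n4]].
  have -> : (u * v) m - (u * v) n = u m * (v m - v n) + (u m - u n) * v n.
    by rewrite -[LHS]/(u m * v m - u n * v n); ring.
  apply: le_lt_trans (padic_absD _ _ _) _; rewrite !padic_absM [e]splitr.
  apply: ltrD.
  + rewrite -[ltRHS](divfK (lt0r_neq0 B0)) mulrC.
    by apply: ltr_pM; rewrite ?padic_abs_ge0 ?h4 ?hB.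
  + rewrite -[ltRHS](divfK (lt0r_neq0 C0)).
    by apply: ltr_pM; rewrite ?padic_abs_ge0 ?h3 ?hC.
Qed.

HB.instance Definition _ :=
  GRing.isSubringClosed.Build (nat -> rat) (padic_cauchy p) padic_cauchy_subring.

End CauchyRing.

Record padic_cauchy_seq (p : nat) := PadicCauchySeq {
  padic_cauchy_fun :> nat -> rat ;
  padic_cauchy_funP : padic_cauchy_fun \in padic_cauchy p }.

HB.instance Definition _ p := [isSub for @padic_cauchy_fun p].
HB.instance Definition _ p := [Choice of padic_cauchy_seq p by <:].
HB.instance Definition _ p :=
  [SubChoice_isSubComNzRing of padic_cauchy_seq p by <:].

Definition padic_null (p : nat) : {pred padic_cauchy_seq p} :=
  [pred u : padic_cauchy_seq p | `[< forall e : rat, 0 < e ->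
     exists M : nat, forall n, (M <= n)%N -> padic_abs p (u n) < e >]].

Arguments padic_null p : clear implicits.

Section NullIdeal.
Variable p : nat.
Local Notation pabs := (padic_abs p).
Implicit Types u v : padic_cauchy_seq p.

Lemma padic_nullP u : reflect
  (forall e : rat, 0 < e ->
     exists M : nat, forall n, (M <= n)%N -> pabs (u n) < e)
  (u \in padic_null p).
Proof. exact: asboolP. Qed.

Lemma padic_cauchy0E n : (0 : padic_cauchy_seq p) n = 0. Proof. by []. Qed.
Lemma padic_cauchy1E n : (1 : padic_cauchy_seq p) n = 1. Proof. by []. Qed.
Lemma padic_cauchyNE u n : (- u) n = - u n. Proof. by []. Qed.
Lemma padic_cauchyDE u v n : (u + v) n = u n + v n. Proof. by []. Qed.
Lemma padic_cauchyME u v n : (u * v) n = u n * v n. Proof. by []. Qed.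
Definition padic_cauchyE := (padic_cauchy0E, padic_cauchy1E, padic_cauchyNE,
  padic_cauchyDE, padic_cauchyME).

Lemma padic_null_ideal : idealr_closed (padic_null p).
Proof.
split.
- by apply/padic_nullP => e e0; exists 0%N => n _; rewrite padic_cauchyE padic_abs0.
- apply/negP => /padic_nullP /(_ 1 ltr01) [M /(_ M (leqnn M))].
  by rewrite padic_cauchyE padic_abs1 ltxx.
- move=> w u v /padic_nullP hu /padic_nullP hv; apply/padic_nullP => e e0.
  have [B B0 [M1 hB]] := padic_cauchy_bounded (padic_cauchy_funP w).
  have eB : 0 < e / 2 / B by rewrite !divr_gt0.
  have e2 : 0 < e / 2 by rewrite !divr_gt0.
  have [M2 h2] := hu _ eB; have [M3 h3] := hv _ e2.
  exists (maxn M1 (maxn M2 M3)) => n; rewrite !geq_max => /and3P[n1 n2 n3].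
  rewrite !padic_cauchyE; apply: le_lt_trans (padic_absD _ _ _) _.
  rewrite padic_absM [e]splitr; apply: ltrD; last exact: h3.
  rewrite -[ltRHS](divfK (lt0r_neq0 B0)) mulrC.
  by apply: ltr_pM; rewrite ?padic_abs_ge0 ?h2 ?hB.
Qed.

HB.instance Definition _ :=
  isIdealr.Build (padic_cauchy_seq p) (padic_null p) padic_null_ideal.

End NullIdeal.

(* Q_p, as the ring of Cauchy sequences of rationals for padic_abs p, modulo
   the ideal of null sequences. *)
Definition padic (p : nat) : Type := {ideal_quot (padic_null p)}.

HB.instance Definition _ p := GRing.ComNzRing.on (padic p).

Definition padic_of (p : nat) (u : padic_cauchy_seq p) : padic p :=
  \pi_({ideal_quot (padic_null p)}) u.

Section PadicField.
Variable p : nat.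
Local Notation pabs := (padic_abs p).
Implicit Types (u v : padic_cauchy_seq p) (x y z : padic p).

Lemma padic_of_eq u v : (padic_of u == padic_of v) = (u - v \in padic_null p).
Proof. by rewrite Quotient.idealrBE. Qed.

Lemma padic_of_zmod_morphism : zmod_morphism (@padic_of p).
Proof. exact: rmorphB. Qed.

Lemma padic_of_monoid_morphism : monoid_morphism (@padic_of p).
Proof. by split; [exact: rmorph1 | exact: rmorphM]. Qed.

HB.instance Definition _ := GRing.isZmodMorphism.Build
  (padic_cauchy_seq p) (padic p) (@padic_of p) padic_of_zmod_morphism.
HB.instance Definition _ := GRing.isMonoidMorphism.Build
  (padic_cauchy_seq p) (padic p) (@padic_of p) padic_of_monoid_morphism.

Lemma padic_of_eq0 u : (padic_of u == 0) = (u \in padic_null p).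
Proof. by rewrite -(rmorph0 (@padic_of p)) padic_of_eq subr0. Qed.

Definition padic_repr x : padic_cauchy_seq p :=
  repr (x : {ideal_quot (padic_null p)}).

Lemma padic_reprK : cancel padic_repr (@padic_of p).
Proof. by move=> x; rewrite /padic_of reprK. Qed.

Lemma padic_not_null_stable u : u \notin padic_null p ->
  exists2 c, 0 < c & exists M : nat, forall n, (M <= n)%N -> pabs (u n) = c.
Proof.
move=> /padic_nullP /existsNP[e] /not_implyP[e0] /forallNP h.
have [M hM] := padic_cauchyP _ _ (padic_cauchy_funP u) _ e0.
have /existsNP[n0 /not_implyP[Mn0 /negP]] := h M; rewrite -leNgt => en0.
exists (pabs (u n0)); first exact: lt_le_trans en0.
exists M => n Mn; rewrite -[u n](subrK (u n0)) addrC padic_absD_eq //.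
by apply: lt_le_trans en0; exact: hM.
Qed.

Lemma padic_cauchyV u : u \notin padic_null p ->
  (fun n => (u n)^-1) \in padic_cauchy p.
Proof.
move=> /padic_not_null_stable[c c0 [M1 h1]]; apply/padic_cauchyP => e e0.
have ec0 : 0 < e * (c * c) by rewrite !mulr_gt0.
have [M2 h2] := padic_cauchyP _ _ (padic_cauchy_funP u) _ ec0.
exists (maxn M1 M2) => m n; rewrite !geq_max => /andP[m1 m2] /andP[n1 n2].
have um0 : u m != 0 by rewrite -(padic_abs_eq0 p) h1 // gt_eqF.
have un0 : u n != 0 by rewrite -(padic_abs_eq0 p) h1 // gt_eqF.
have -> : (u m)^-1 - (u n)^-1 = (u n - u m) / (u m * u n).
  by field; rewrite um0 un0.
by rewrite padic_absM padic_absV padic_absM !h1 // ltr_pdivrMr ?mulr_gt0 // h2.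
Qed.

Definition padic_inv x : padic p :=
  if x == 0 then 0 else padic_of (insubd 0 (fun n => (padic_repr x n)^-1)).

Lemma padic_mulVf x : x != 0 -> padic_inv x * x = 1.
Proof.
move=> x0; have u0 : padic_repr x \notin padic_null p.
  by rewrite -padic_of_eq0 padic_reprK.
rewrite /padic_inv (negbTE x0) -[x in _ * x]padic_reprK -rmorphM.
apply/eqP; rewrite -(rmorph1 (@padic_of p)) padic_of_eq; apply/padic_nullP.
have [c c0 [M h]] := padic_not_null_stable u0 => e e0.
exists M => n Mn; rewrite !padic_cauchyE /insubd insubT ?padic_cauchyV //= => _.
rewrite mulVf ?subrr ?padic_abs0 //.
by rewrite -(padic_abs_eq0 p) h // gt_eqF.
Qed.

Lemma padic_inv0 : padic_inv 0 = 0.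
Proof. by rewrite /padic_inv eqxx. Qed.

HB.instance Definition _ :=
  GRing.ComNzRing_isField.Build (padic p) padic_mulVf padic_inv0.

(* The p-adic absolute value takes its values in {0} and the powers of p, so it
   is rat-valued; rat^o is rat with its usual topology. It cannot be registered
   as a MathComp norm, because normrMn would require |x *+ n| = |x| *+ n. *)
Definition padic_norm x : rat :=
  lim ((fun n => padic_abs p (padic_repr x n) : rat^o) @ \oo).

Lemma padic_norm0 : padic_norm 0 = 0.
Proof.
apply: (@cvg_lim rat^o) => //.
have /padic_nullP h : padic_repr 0 \in padic_null p.
  by rewrite -padic_of_eq0 padic_reprK.
apply/cvgrPdist_lt => e e0; have [M hM] := h e e0.
exists M => // n /= Mn; rewrite sub0r normrN ger0_norm ?padic_abs_ge0 //.
exact: hM.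
Qed.

Lemma padic_norm_near u : u \notin padic_null p ->
  exists M : nat, forall n, (M <= n)%N -> pabs (u n) = padic_norm (padic_of u).
Proof.
move=> /padic_not_null_stable[c c0 [M1 h1]].
suff -> : padic_norm (padic_of u) = c by exists M1.
have /padic_nullP/(_ c c0)[M2 h2] : padic_repr (padic_of u) - u \in padic_null p.
  by rewrite -padic_of_eq padic_reprK.
apply: (@cvg_lim rat^o) => //; apply: cvg_near_cst.
exists (maxn M1 M2) => // n /=; rewrite geq_max => /andP[n1 n2].
rewrite -[X in pabs X](subrK (u n)) addrC padic_absD_eq ?h1 //.
exact: h2.
Qed.

Lemma padic_norm_le u (c : rat) : 0 <= c ->
  (exists M : nat, forall n, (M <= n)%N -> pabs (u n) <= c) ->
  padic_norm (padic_of u) <= c.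
Proof.
move=> c0 [M h]; have [|/padic_norm_near[M' h']] := boolP (u \in padic_null p).
  by rewrite -padic_of_eq0 => /eqP ->; rewrite padic_norm0.
by rewrite -(h' (maxn M M')) ?leq_maxr // h // leq_maxl.
Qed.

Lemma padic_norm_gt0 x : x != 0 -> 0 < padic_norm x.
Proof.
rewrite -[x]padic_reprK padic_of_eq0 => u0.
have [M h] := padic_norm_near u0; have [c c0 [M' h']] := padic_not_null_stable u0.
by rewrite -(h (maxn M M')) ?leq_maxl // h' // leq_maxr.
Qed.

Lemma padic_norm_ge0 x : 0 <= padic_norm x.
Proof.
by have [->|/padic_norm_gt0/ltW//] := eqVneq x 0; rewrite padic_norm0.
Qed.

Lemma padic_norm_eq0 x : (padic_norm x == 0) = (x == 0).
Proof.
have [->|x0] := eqVneq x 0; first by rewrite padic_norm0 eqxx.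
by rewrite gt_eqF // padic_norm_gt0.
Qed.

Lemma padic_normN x : padic_norm (- x) = padic_norm x.
Proof.
have [->|x0] := eqVneq x 0; first by rewrite oppr0.
have : - x != 0 by rewrite oppr_eq0.
move: x0; rewrite -[x]padic_reprK -rmorphN !padic_of_eq0.
move=> /padic_norm_near[M h] /padic_norm_near[M' h'].
rewrite -(h (maxn M M')) ?leq_maxl // -(h' (maxn M M')) ?leq_maxr //.
exact: padic_absN.
Qed.

Lemma padic_normM x y : padic_norm (x * y) = padic_norm x * padic_norm y.
Proof.
have [->|x0] := eqVneq x 0; first by rewrite mul0r padic_norm0 mul0r.
have [->|y0] := eqVneq y 0; first by rewrite mulr0 padic_norm0 mulr0.
have : x * y != 0 by rewrite mulf_neq0.
move: x0 y0; rewrite -[x]padic_reprK -[y]padic_reprK -rmorphM !padic_of_eq0.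
move=> /padic_norm_near[M h] /padic_norm_near[M' h'] /padic_norm_near[N k].
pose n := maxn N (maxn M M').
rewrite -(h n) -?(h' n) -?(k n) ?leq_max ?leqnn ?orbT //.
exact: padic_absM.
Qed.

Lemma padic_normD_max x y :
  padic_norm (x + y) <= Num.max (padic_norm x) (padic_norm y).
Proof.
have [->|x0] := eqVneq x 0; first by rewrite add0r le_max lexx orbT.
have [->|y0] := eqVneq y 0; first by rewrite addr0 le_max lexx.
move: x0 y0; rewrite -[x]padic_reprK -[y]padic_reprK -rmorphD !padic_of_eq0.
move=> /padic_norm_near[M h] /padic_norm_near[M' h'].
apply: padic_norm_le; first by rewrite le_max padic_norm_ge0.
exists (maxn M M') => n; rewrite geq_max => /andP[n1 n2].
by rewrite -(h n) // -(h' n) //; exact: padic_absD_max.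
Qed.

Lemma padic_normD x y : padic_norm (x + y) <= padic_norm x + padic_norm y.
Proof.
apply: le_trans (padic_normD_max x y) _.
by rewrite ge_max lerDl lerDr !padic_norm_ge0.
Qed.

Definition padic_dist x y : rat := padic_norm (x - y).

Lemma padic_distxx x : padic_dist x x = 0.
Proof. by rewrite /padic_dist subrr padic_norm0. Qed.

Lemma padic_dist_eq0 x y : padic_dist x y = 0 -> x = y.
Proof. by move/eqP; rewrite padic_norm_eq0 subr_eq0 => /eqP. Qed.

Lemma padic_distC x y : padic_dist x y = padic_dist y x.
Proof. by rewrite /padic_dist -padic_normN opprB. Qed.

Lemma padic_dist_triangle y x z :
  padic_dist x z <= padic_dist x y + padic_dist y z.
Proof.
apply: le_trans (padic_normD _ _).
by rewrite /padic_dist addrA subrK.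
Qed.

HB.instance Definition _ := isPointed.Build (padic p) 0.
HB.instance Definition _ := isMetric.Build rat (padic p)
  padic_distxx padic_dist_eq0 padic_distC padic_dist_triangle.

End PadicField.

Section PadicCompletion.
Variable p : nat.
Local Notation pabs := (padic_abs p).

Lemma padic_cauchy_cst (q : rat) : (fun=> q) \in padic_cauchy p.
Proof.
by apply/padic_cauchyP => e e0; exists 0%N => m n _ _; rewrite subrr padic_abs0.
Qed.

Definition padic_of_rat (q : rat) : padic p :=
  padic_of (PadicCauchySeq (padic_cauchy_cst q)).

Lemma padic_of_rat_zmod_morphism : zmod_morphism padic_of_rat.
Proof.
move=> q r; rewrite /padic_of_rat -rmorphB; congr padic_of.
exact/val_inj.
Qed.

Lemma padic_of_rat_monoid_morphism : monoid_morphism padic_of_rat.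
Proof.
split=> [|q r]; rewrite /padic_of_rat.
  by rewrite -(rmorph1 (@padic_of p)); congr padic_of; exact/val_inj.
by rewrite -rmorphM; congr padic_of; exact/val_inj.
Qed.

HB.instance Definition _ :=
  GRing.isZmodMorphism.Build rat (padic p) padic_of_rat
    padic_of_rat_zmod_morphism.
HB.instance Definition _ :=
  GRing.isMonoidMorphism.Build rat (padic p) padic_of_rat
    padic_of_rat_monoid_morphism.

Lemma padic_of_ratE : padic_of_rat =1 ratr.
Proof. exact: fmorph_eq_rat. Qed.

Lemma padic_norm_ratr (q : rat) : padic_norm (ratr q : padic p) = pabs q.
Proof.
rewrite -padic_of_ratE; have [->|q0] := eqVneq q 0.
  by rewrite rmorph0 padic_norm0 padic_abs0.
have : padic_of_rat q != 0 by rewrite fmorph_eq0.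
by rewrite padic_of_eq0 => /padic_norm_near[M /(_ M (leqnn M))] <-.
Qed.

Lemma padic_of_cvg (u : padic_cauchy_seq p) (e : rat) : 0 < e ->
  exists M : nat, forall n, (M <= n)%N -> padic_dist (padic_of u) (ratr (u n)) < e.
Proof.
move=> e0; have e2 : 0 < e / 2 by rewrite divr_gt0.
have [M h] := padic_cauchyP _ _ (padic_cauchy_funP u) _ e2.
exists M => n Mn; apply: (@le_lt_trans _ _ (e / 2)); last first.
  by rewrite ltr_pdivrMr // ltr_pMr // ltr1n.
rewrite /padic_dist -padic_of_ratE -rmorphB; apply: padic_norm_le (ltW e2) _.
exists M => m Mm; rewrite -[X in pabs X]/(u m - u n).
by rewrite ltW // h.
Qed.

Lemma padic_rat_dense (x : padic p) (e : rat) : 0 < e ->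
  exists q : rat, padic_dist x (ratr q) < e.
Proof.
by move=> /(padic_of_cvg (padic_repr x))[M /(_ M (leqnn M))];
  rewrite padic_reprK; exists (padic_repr x M).
Qed.

Lemma padic_ballP (x y : padic p) (e : rat) :
  ball x e y <-> padic_dist x y < e.
Proof. by rewrite ballEmdist. Qed.

Lemma padic_cauchy_cvg (F : set_system (padic p)) :
  ProperFilter F -> cauchy F -> cvg F.
Proof.
move=> FF /(@cauchyP rat) Fc.
have inv0 n : 0 < n.+1%:R^-1 :> rat by rewrite invr_gt0.
have inv_small (e : rat) : 0 < e ->
    exists M : nat, forall n, (M <= n)%N -> n.+1%:R^-1 < e.
  move=> e0; exists (Num.bound e^-1) => n Mn.
  rewrite -(invrK e) ltf_pV2 ?posrE ?invr_gt0 //.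
  apply: lt_le_trans (archi_boundP _) _; first by rewrite invr_ge0 ltW.
  by rewrite ler_nat ltnW.
have /choice[q Fq] : forall n : nat, exists q : rat,
    F (ball (ratr q : padic p) (n.+1%:R^-1)).
  move=> n; have e2 : 0 < n.+1%:R^-1 / 2 :> rat by rewrite divr_gt0.
  have [x Fx] := Fc _ e2; have [q xq] := padic_rat_dense x e2.
  exists q; apply: filterS Fx => y /padic_ballP xy; apply/padic_ballP.
  apply: le_lt_trans (padic_dist_triangle x _ _) _.
  by rewrite padic_distC [ltRHS]splitr ltrD.
have qC : q \in padic_cauchy p.
  apply/padic_cauchyP => e e0; have e2 : 0 < e / 2 by rewrite divr_gt0.
  have [M h] := inv_small _ e2; exists M => m n Mm Mn.
  have [y [/padic_ballP ym /padic_ballP yn]] :=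
    @filter_ex _ F _ _ (filterI (Fq m) (Fq n)).
  rewrite -padic_norm_ratr -padic_of_ratE rmorphB /= !padic_of_ratE.
  apply: le_lt_trans (padic_dist_triangle y _ _) _.
  rewrite [e]splitr; apply: ltrD; first exact: lt_trans (h m Mm).
  by rewrite padic_distC; exact: lt_trans (h n Mn).
apply/cvg_ex; exists (padic_of (PadicCauchySeq qC)).
apply/cvg_ballP => e e0; have e2 : 0 < e / 2 by rewrite divr_gt0.
have [M h] := inv_small _ e2.
have [M' h'] := padic_of_cvg (PadicCauchySeq qC) e2.
pose n := maxn M M'; rewrite near_simpl /=.
apply: filterS (Fq n) => y /padic_ballP qy; apply/padic_ballP.
apply: le_lt_trans (padic_dist_triangle (ratr (q n)) _ _) _.
rewrite [e]splitr; apply: ltrD; first by apply: h'; rewrite leq_maxr.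
by apply: lt_trans qy _; apply: h; rewrite leq_maxl.
Qed.

HB.instance Definition _ :=
  Uniform_isComplete.Build (padic p) padic_cauchy_cvg.

End PadicCompletion.

Definition phi_coef (eps q : rat) (gamma delta N n : nat) : rat :=
  let m := (gamma * n + delta)%N in
  eps ^+ n * ((m`!)%:R ^+ m / (q + (m`!)%:R ^+ (N * m)%N)) / (m`!)%:R.

Definition phi_term (K : fieldType) (eps q : rat) (gamma delta N : nat) (x : K)
    (n : nat) : K :=
  ratr (phi_coef eps q gamma delta N n) * x ^+ (gamma * n + delta)%N.

(* Main.v *)
(** Write [m = gamma n + delta], [f = m!] and [c_m] for the coefficient of
    [x^m], up to sign.  Over the reals, [f^m <= q + f^(N m)] gives
    [c_m <= 1/m!], and the series is dominated by a subseries of [exp |x|].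
    Over [Q_p] a series converges as soon as its terms tend to 0.  Since
    [|f|_p -> 0], eventually [|q + f^(N m)|_p = |q|_p], so that
    [|c_m x^m|_p = (|f|_p |x|_p)^(m-1) |x|_p / |q|_p], which tends to 0. *)
Require Import Defs.
From mathcomp Require Import all_boot all_order all_algebra.
From mathcomp Require Import all_classical all_reals all_analysis.
From mathcomp Require Import ring.
Import Order.TTheory GRing.Theory Num.Theory.
Import numFieldNormedType.Exports.
Local Open Scope classical_set_scope.
Local Open Scope ring_scope.

(** A strictly increasing [s] picks distinct indices, so the first n terms of the subseries are
    among the first [s n] terms of [u]; its nondecreasing partial sums stay below the full sum. *)
Lemma is_cvg_series_subseq (R : realType) (u : R^nat) (s : nat -> nat) :
  (forall n, 0 <= u n) -> (forall n, (s n < s n.+1)%N) ->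
  cvgn (series u) -> cvgn (series (u \o s)).
Proof.
move=> u0 s_lt cu.
have mono (v : R^nat) (v0 : forall n, 0 <= v n) :
    {homo series v : m n / (m <= n)%N >-> m <= n}.
  by move=> m n mn; apply: nondecreasing_series.
apply: nondecreasing_is_cvgn; first by apply: mono => n /=.
have le_su n : series (u \o s) n <= series u (s n).
  elim: n => [|n IHn]; first by rewrite /series /= big_geq // sumr_ge0.
  apply: le_trans (mono u u0 _ _ (s_lt n)).
  by rewrite !seriesSr lerD.
exists (limn (series u)) => _ [n _ <-].
apply: le_trans (le_su n) _.
by apply: nondecreasing_cvgn_le => //; exact: mono.
Qed.

Lemma padic_abs_nat_le1 (p n : nat) : padic_abs p n%:R <= 1.
Proof.
elim: n => [|n IHn]; first by rewrite padic_abs0.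
rewrite -natr1; apply: le_trans (padic_absD_max _ _ _) _.
by rewrite ge_max IHn padic_abs1 /=.
Qed.

Lemma padic_absX (p n : nat) (x : rat) :
  padic_abs p (x ^+ n) = padic_abs p x ^+ n.
Proof.
by elim: n => [|n IHn]; rewrite ?expr0 ?padic_abs1 // !exprS padic_absM IHn.
Qed.

Lemma padic_abs_prime (p : nat) : prime p -> padic_abs p p%:R = p%:R^-1.
Proof.
move=> pp; rewrite /padic_abs pnatr_eq0 eqn0Ngt prime_gt0 //=.
rewrite -[p%:R]/((p%:Z)%:~R) /padic_val numq_int denq_int /=.
by rewrite logn1 logn_prime // eqxx.
Qed.

(** Once m >= p^k, the power p^k divides m!, so |m!|_p <= p^-k. With k > 1/e, the inequality p^k > k
    makes this less than e. *)
Lemma padic_abs_fact_cvg0 (p : nat) (e : rat) : prime p -> 0 < e ->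
  \forall m \near \oo, padic_abs p (m`!)%:R < e.
Proof.
move=> pp e0; pose k := Num.bound e^-1; exists (p ^ k)%N => // m /= km.
have pk_gt0 : (0 < p ^ k)%N by rewrite expn_gt0 prime_gt0.
have /dvdnP[c ->] : (p ^ k %| m`!)%N by apply: dvdn_fact; rewrite pk_gt0.
rewrite natrM natrX padic_absM padic_absX padic_abs_prime //.
have pk0 : (0 : rat) <= p%:R^-1 ^+ k by rewrite exprn_ge0.
apply: le_lt_trans (ler_wpM2r pk0 (padic_abs_nat_le1 _ _)) _.
rewrite mul1r exprVn -natrX -(invrK e) ltf_pV2 ?posrE ?invr_gt0 ?ltr0n //.
apply: lt_trans (archi_boundP _) _; first by rewrite invr_ge0 ltW.
by rewrite ltr_nat ltn_expl // prime_gt1.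
Qed.

Lemma padic_normX (p n : nat) (x : padic p) :
  padic_norm (x ^+ n) = padic_norm x ^+ n.
Proof.
elim: n => [|n IHn]; last by rewrite !exprS padic_normM IHn.
rewrite !expr0.
have <- : ratr 1 = 1 :> padic p by rewrite -padic_of_ratE rmorph1.
by rewrite padic_norm_ratr padic_abs1.
Qed.

(** The ultrametric inequality bounds a block of terms by its largest one, so small terms make the
    partial sums Cauchy, and [padic p] is complete. *)
Lemma padic_is_cvg_series (p : nat) (u : nat -> padic p) :
  (forall e : rat, 0 < e -> \forall n \near \oo, padic_norm (u n) < e) ->
  cvgn (series u).
Proof.
move=> u0; apply: padic_cauchy_cvg; apply: cauchy_exP => e e0.
have [M _ hM] := u0 e e0.
exists (series u M); exists M => // n /= Mn; apply/padic_ballP.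
rewrite padic_distC /padic_dist; rewrite -(subnKC Mn).
elim: (n - M)%N => [|k IHk]; first by rewrite addn0 subrr padic_norm0.
rewrite addnS seriesSr addrAC.
apply: le_lt_trans (padic_normD_max _ _) _.
by rewrite gt_max IHk hM //= leq_addr.
Qed.

Section PhiSeries.
Variables (eps q : rat) (gamma delta N : nat).
Hypotheses (heps : eps = 1 \/ eps = -1) (hq : 0 < q).
Hypotheses (hgamma : (0 < gamma)%N) (hN : (0 < N)%N).

Lemma phi_coef_le n :
  `|phi_coef eps q gamma delta N n| <= ((gamma * n + delta)`!)%:R^-1.
Proof.
rewrite /phi_coef; set m := (gamma * n + delta)%N.
have f1 : 1 <= (m`!)%:R :> rat by rewrite ler1n fact_gt0.
have f0 : 0 < (m`!)%:R :> rat := lt_le_trans ltr01 f1.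
have d0 : 0 < q + (m`!)%:R ^+ (N * m)%N by rewrite addr_gt0 // exprn_gt0.
have eps1 : `|eps| = 1 by case: heps => ->; rewrite ?normrN normr1.
rewrite !normrM normrX eps1 expr1n mul1r !normfV normrX.
rewrite (gtr0_norm d0) (gtr0_norm f0) ler_piMl ?invr_ge0 //.
rewrite ler_pdivrMr // mul1r.
(* Both f >= 1 and N >= 1 enter here: f^m <= f^(N m) <= q + f^(N m). *)
apply: le_trans (_ : (m`!)%:R ^+ (N * m)%N <= _); last by rewrite lerDr ltW.
by rewrite ler_weXn2l // leq_pmull.
Qed.

Lemma phi_series_real_cvg (R : realType) (x : R) :
  cvgn (series (phi_term eps q gamma delta N x)).
Proof.
apply: normed_cvg; pose s n := (gamma * n + delta)%N.
apply: (@series_le_cvg _ _ (exp_coeff `|x| \o s)) => [n|n|n|] /=.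
- by rewrite normr_ge0.
- by rewrite divr_ge0 ?exprn_ge0.
- rewrite /phi_term normrM normrX -ratr_norm mulrC ler_wpM2l ?exprn_ge0 //.
  by rewrite -(ratr_nat R) -fmorphV ler_rat phi_coef_le.
(* Since gamma > 0, [s] is strictly increasing, so the dominating terms form a subseries of exp
   |x|. *)
- apply: is_cvg_series_subseq (is_cvg_series_exp_coeff _) => n.
    by rewrite divr_ge0 ?exprn_ge0.
  by rewrite ltn_add2r ltn_pmul2l.
Qed.

(** Division by m! cancels one of the m factors f, hence the exponent m - 1 and one factor |x|_p
    left over. *)
Lemma padic_norm_phi_term (p : nat) (x : padic p) n :
  let m := (gamma * n + delta)%N in
  let f := padic_abs p (m`!)%:R in
  (0 < m)%N -> f < padic_abs p q ->
  padic_norm (phi_term eps q gamma delta N x n) =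
    (f * padic_norm x) ^+ m.-1 * (padic_norm x / padic_abs p q).
Proof.
move=> m f m0 fq.
have f1 : f <= 1 := padic_abs_nat_le1 p _.
have f0 : f != 0 by rewrite padic_abs_eq0 pnatr_eq0 -lt0n fact_gt0.
have eps1 : padic_abs p eps = 1.
  by case: heps => ->; rewrite ?padic_absN padic_abs1.
(* As N m >= 1 and f <= 1, f^(N m) <= f < |q|_p, so q strictly dominates the sum. *)
have dq : padic_abs p (q + (m`!)%:R ^+ (N * m)%N) = padic_abs p q.
  rewrite padic_absD_eq // padic_absX; apply: le_lt_trans fq.
  have -> : (N * m)%N = (N * m).-1.+1 by rewrite prednK // muln_gt0 hN.
  by rewrite exprS ler_piMr ?padic_abs_ge0 // exprn_ile1 ?padic_abs_ge0.
rewrite /phi_term /phi_coef -/m padic_normM padic_normX padic_norm_ratr.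
rewrite !padic_absM !padic_absV !padic_absX eps1 dq -/f expr1n mul1r.
rewrite -[in LHS](prednK m0) /= !exprS exprMn.
by field; rewrite f0 padic_abs_eq0 gt_eqF.
Qed.

(** With K = |x|_p, it suffices that m >= 2 and that f = |m!|_p is below |q|_p (for the closed form
    of the term), below 1/(K + 1) (so that f K <= 1) and below e/(K^2/|q|_p + 1) (so that f
    K^2/|q|_p < e). *)
Lemma phi_series_padic_cvg (p : nat) (x : padic p) : prime p ->
  cvgn (series (phi_term eps q gamma delta N x)).
Proof.
move=> pp; apply: padic_is_cvg_series => e e0.
set K := padic_norm x; have K0 : 0 <= K := padic_norm_ge0 x.
have aq0 : 0 < padic_abs p q by rewrite padic_abs_gt0 ?gt_eqF.
(* Adding 1 keeps both divisors positive even when x = 0. *)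
have C0 : 0 < K * (K / padic_abs p q) + 1.
  by rewrite ltr_wpDl // !mulr_ge0 // invr_ge0 ltW.
have K10 : 0 < K + 1 by rewrite ltr_wpDl.
(* Since gamma >= 1, n <= gamma n + delta, so properties of all large m pass to the exponents. *)
have near_s (P : nat -> Prop) : (\forall m \near \oo, P m) ->
    \forall n \near \oo, P (gamma * n + delta)%N.
  move=> [M _ hM]; exists M => // n /= Mn; apply: hM => /=.
  by rewrite (leq_trans Mn) // (leq_trans _ (leq_addr _ _)) // leq_pmull.
have := padic_abs_fact_cvg0 _ _ pp aq0.
have eK0 : 0 < (K + 1)^-1 by rewrite invr_gt0.
have := padic_abs_fact_cvg0 _ _ pp eK0.
have eC0 := divr_gt0 e0 C0.
have := padic_abs_fact_cvg0 _ _ pp eC0.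
move=> /near_s nC /near_s nK /near_s nq.
have /near_s n1 := nbhs_infty_gt 1%N.
near=> n.
set m := (gamma * n + delta)%N; set f := padic_abs p (m`!)%:R.
have f0 : 0 <= f := padic_abs_ge0 p _.
have m1 : (1 < m)%N by rewrite /m; near: n.
have fK : f * K <= 1.
  have /ltW : f < (K + 1)^-1 by rewrite /f /m; near: n.
  move=> /(ler_wpM2r K0)/le_trans; apply.
  by rewrite mulrC ler_pdivrMr // mul1r lerDl.
have fC : f * (K * (K / padic_abs p q)) < e.
  have : f < e / (K * (K / padic_abs p q) + 1) by rewrite /f /m; near: n.
  rewrite ltr_pdivlMr //; apply: le_lt_trans.
  by rewrite ler_wpM2l // lerDl.
rewrite padic_norm_phi_term //; [|exact: ltnW|by near: n].
apply: le_lt_trans fC; rewrite -/m -/f -/K [leRHS]mulrA.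
apply: ler_wpM2r; first by rewrite divr_ge0 // ltW.
(* One factor f K is split off; the remaining (f K)^(m-2) is at most 1. *)
have -> : m.-1 = m.-2.+1 by case: (m) m1 => [|[]].
by rewrite exprS ler_piMr ?mulr_ge0 // exprn_ile1 // mulr_ge0.
Unshelve. all: by end_near.
Qed.

End PhiSeries.

Theorem theorem4p8 (R : realType) (eps q : rat) (gamma delta N : nat)
    (heps : eps = 1 \/ eps = -1) (hq : 0 < q)
    (hgamma : (0 < gamma)%N) (hN : (0 < N)%N) :
  (forall x : R, cvgn (series (phi_term eps q gamma delta N x))) /\
  (forall p : nat, prime p ->
     forall x : padic p, cvgn (series (phi_term eps q gamma delta N x))).
Proof.
split=> [x|p pp x]; first exact: phi_series_real_cvg.
exact: phi_series_padic_cvg.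
Qed.
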